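(* 1) For every positive integer $n$ with $n\not\equiv \pm 3 \pmod 9$, one has $\nu(n)\geq 1$. 2) For every positive integer $n$ with $n\equiv \pm 3 \pmod 9$, one has $\nu(n)=0$.
   Context: Let $F(x,y,z)=x^3+y^3+z^3-3xyz$. For a positive integer $n$, $\nu(n)$ denotes the number of triples of integers $(x,y,z)$ with $0\leq x\leq y\leq z$ and $z\geq x+1$ such that $F(x,y,z)=n$. *)

(* Defs.v *)
From mathcomp Require Import all_boot all_order all_algebra finmap.
From mathcomp Require Import boolp classical_sets cardinality.
From mathcomp Require Import zify lra ring.
Set Implicit Arguments.
Unset Strict Implicit.
Unset Printing Implicit Defensive.
Import Order.TTheory GRing.Theory Num.Theory.
Local Open Scope classical_set_scope.
Local Open Scope ring_scope.

Definition F (x y z : int) : int :=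
  x ^+ 3 + y ^+ 3 + z ^+ 3 - 3 * x * y * z.

(* The triple (x, y, z) is encoded as the left-nested pair ((x, y), z). *)
Definition solutions (n : int) : set (int * int * int) :=
  [set t | let: (x, y, z) := t in
    [/\ 0 <= x, x <= y, y <= z, z >= x + 1 & F x y z = n]].

(* [fset_set A] is the empty finite set when [A] is infinite; this case does
   not occur here, see [finite_solutions]. *)
Definition nu (n : int) : nat := #|` fset_set (solutions n)|%fset.

Lemma solutions_le (n x y z : int) : solutions n (x, y, z) -> z <= n.
Proof.
case=> x0 xy yz zx <-.
have [a xE] : exists a : nat, x = a by exists `|x|%N; lia.
have [b yE] : exists b : nat, y = x + b%:Z by exists `|y - x|%N; lia.
have [c zE] : exists c : nat, z = y + c%:Z by exists `|z - y|%N; lia.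
have q1 : 1 <= (b%:Z ^+ 2 + b%:Z * c%:Z + c%:Z ^+ 2) by nia.
have -> : F x y z = (x + y + z) * (b%:Z ^+ 2 + b%:Z * c%:Z + c%:Z ^+ 2).
  by rewrite /F zE yE; ring.
by nia.
Qed.

Lemma finite_solutions (n : int) : finite_set (solutions n).
Proof.
pose r := [seq Posz i | i <- iota 0 `|n|.+1].
apply: (@sub_finite_set _ _ [set` [seq (p, z) | p <- [seq (x, y) | x <- r, y <- r], z <- r]]);
  last exact: finite_seq.
have rP (u : int) : 0 <= u -> u <= n -> u \in r.
  move=> u0 un; apply/mapP; exists `|u|%N; last lia.
  by rewrite mem_iota; lia.
move=> [[x y] z] s; have zn := solutions_le s; case: s => x0 xy yz zx _.
have [xr yr zr] : [/\ x \in r, y \in r & z \in r] by split; apply: rP; lia.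
apply/allpairsP; exists ((x, y), z); split => //.
by apply/allpairsP; exists (x, y).
Qed.

(* Main.v *)
Require Import Defs.
From mathcomp Require Import all_boot all_order all_algebra.
From mathcomp Require Import finmap boolp classical_sets cardinality.
From mathcomp Require Import zify ring.
Import Order.TTheory GRing.Theory Num.Theory.
Local Open Scope ring_scope.

(** Writing s = x + y + z, one has F x y z = s^3 - 3 s (xy + yz + zx); so if 3
    divides F x y z, it divides s, and then 9 divides F x y z. Conversely, the
    triples (k, k, k+1), (k, k+1, k+1) and (k, k+1, k+2) give the values
    3k + 1, 3k + 2 and 9(k + 1). *)

Lemma nu_gt0 (n x y z : int) : solutions n (x, y, z) -> (1 <= nu n)%N.
Proof.
move=> s; rewrite /nu cardfs_gt0; apply/fset0Pn; exists (x, y, z).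
(* [fset_set] sends infinite sets to the empty set, so membership needs finiteness. *)
by rewrite in_fset_set ?inE//; exact: finite_solutions.
Qed.

Lemma F_dvd3_dvd9 (x y z : int) : (3 %| F x y z)%Z -> (9 %| F x y z)%Z.
Proof.
set s := x + y + z; pose q := x * y + y * z + z * x.
have -> : F x y z = s ^+ 3 - 3 * (s * q) by rewrite /F /s /q; ring.
rewrite rpredBr => [s3|]; last exact: dvdz_mulr.
have /dvdzP[t ->] : (3 %| s)%Z.
  by move: s3; rewrite !dvdzE abszX Euclid_dvdX ?andbT.
(* With s = 3t, s^3 - 3sq = 27t^3 - 9tq. *)
by apply/dvdzP; exists (3 * t ^+ 3 - t * q); ring.
Qed.

Theorem proposition3 :
  (forall n : int, 0 < n ->
     ~ ((n = 3 %[mod 9])%Z \/ (n = -3 %[mod 9])%Z) -> (1 <= nu n)%N) /\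
  (forall n : int, 0 < n ->
     (n = 3 %[mod 9])%Z \/ (n = -3 %[mod 9])%Z -> nu n = 0%N).
Proof.
split=> n n_gt0 n_mod.
  have [[k k_ge0 ->]|[k k_ge0 ->]|[k k_ge0 ->]] :
      [\/ exists2 k, 0 <= k & n = 3 * k + 1, exists2 k, 0 <= k & n = 3 * k + 2
        | exists2 k, 0 <= k & n = 9 * (k + 1)].
  (* The multiples of 3 modulo 9 are 0, 3 and -3, and [n_mod] leaves only 0. *)
  - have [n1|[n2|n0]] : (n %% 3)%Z = 1 \/ (n %% 3)%Z = 2 \/ (n %% 9)%Z = 0 by lia.
    + by apply: Or31; exists (n %/ 3)%Z; lia.
    + by apply: Or32; exists (n %/ 3)%Z; lia.
    (* Here n is a positive multiple of 9, so n / 9 - 1 is nonnegative. *)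
    + by apply: Or33; exists ((n %/ 9)%Z - 1); lia.
  - by apply: (@nu_gt0 _ k k (k + 1)); split; rewrite /F; [lia..|ring].
  - by apply: (@nu_gt0 _ k (k + 1) (k + 1)); split; rewrite /F; [lia..|ring].
  - by apply: (@nu_gt0 _ k (k + 1) (k + 2)); split; rewrite /F; [lia..|ring].
apply/eqP; rewrite /nu cardfs_eq0; apply/eqP/fsetP => -[[x y] z].
rewrite in_fset_set ?in_fset0; last exact: finite_solutions.
apply/negbTE; rewrite notin_setE => -[_ _ _ _ Fn].
(* Integers congruent to 3 or -3 modulo 9 are divisible by 3 but not by 9. *)
by have := F_dvd3_dvd9 x y z; rewrite Fn; lia.
Qed.
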